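(* Let $X$ and $Y$ be finite semimetric spaces. Then the Hasse diagrams $\mathcal H(\mathbf B_X)$ and $\mathcal H(\mathbf B_Y)$ are isomorphic as directed graphs if and only if there exists a bijective ball-preserving mapping $f\colon X\to Y$.
   Context: A semimetric space is a pair $(X,d)$ where $d\colon X\times X\to[0,\infty)$ satisfies $d(x,y)=d(y,x)$ and $d(x,y)=0\Leftrightarrow x=y$ for all $x,y\in X$ (no triangle inequality is assumed). A ball in $(X,d)$ is a set of the form $B_r(t)=\{x\in X\colon d(x,t)\le r\}$ with $r\ge0$ and $t\in X$. $\mathbf B_X$ denotes the set of all balls in $(X,d)$, regarded as a poset under inclusion $\subseteq$. A mapping $F\colon X\to Y$ between semimetric spaces is ball-preserving if for every $Z\in\mathbf B_X$ and every $W\in\mathbf B_Y$ the image $F(Z)$ belongs to $\mathbf B_Y$ and the preimage $F^{-1}(W)$ belongs to $\mathbf B_X$. The Hasse diagram $\mathcal H(P)$ of a finite poset $(P,\le)$ is the directed graph with vertex set $P$ in which $\langle v_1,v_2\rangle$ is an arc iff $v_1\le v_2$, $v_1\ne v_2$, and for every $w\in P$, $v_1\le w\le v_2$ implies $w=v_1$ or $w=v_2$. Two directed graphs are isomorphic if there is a bijection $F$ between their vertex sets such that $\langle x,y\rangle$ is an arc iff $\langle F(x),F(y)\rangle$ is an arc. *)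

(* Defs.v *)
From HB Require Import structures.
From mathcomp Require Import all_boot all_order all_algebra.
From mathcomp Require Import boolp reals.

Set Implicit Arguments.
Unset Strict Implicit.
Unset Printing Implicit Defensive.

Import Order.TTheory GRing.Theory Num.Theory.
Local Open Scope ring_scope.

Definition is_semimetric (R : realType) (X : Type) (d : X -> X -> R) : Prop :=
  [/\ forall x y, 0 <= d x y,
      forall x y, d x y = d y x
    & forall x y, d x y = 0 <-> x = y].

Record finSemimetric (R : realType) := FinSemimetric {
  carrier :> finType;
  sdist : carrier -> carrier -> R;
  sdistP : is_semimetric sdist
}.

Section Balls.
Context {R : realType} (X : finSemimetric R).

Definition cball (t : X) (r : R) : {set X} := [set x | sdist x t <= r].

Definition is_ball (A : {set X}) : Prop :=
  exists (t : X) (r : R), 0 <= r /\ A = cball t r.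

Definition balls : Type := {A : {set X} | `[< is_ball A >]}.

HB.instance Definition _ := Finite.on balls.
HB.instance Definition _ := SubChoice.on balls.

Fact ball_display : Order.disp_t. Proof. by []. Qed.

Definition ball_le (A B : balls) : bool := \val A \subset \val B.

Fact ball_le_refl : reflexive ball_le.
Proof. by move=> A; exact: subxx. Qed.

Fact ball_le_anti : antisymmetric ball_le.
Proof. by move=> A B AB; apply/val_inj/eqP; rewrite eqEsubset. Qed.

Fact ball_le_trans : transitive ball_le.
Proof. by move=> B A C; exact: subset_trans. Qed.

HB.instance Definition _ := Order.Le_isPOrder.Build ball_display balls
  ball_le_refl ball_le_anti ball_le_trans.

End Balls.

Definition ball_preserving (R : realType) (X Y : finSemimetric R)
    (F : X -> Y) : Prop :=
  (forall Z : {set X}, is_ball Z -> is_ball (F @: Z)) /\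
  (forall W : {set Y}, is_ball W -> is_ball (F @^-1: W)).

Record digraph := Digraph { vertex : finType; is_arc : rel vertex }.

Definition digraph_iso (G H : digraph) : Prop :=
  exists F : vertex G -> vertex H,
    bijective F /\ forall x y, is_arc x y <-> is_arc (F x) (F y).

Definition hasse (disp : Order.disp_t) (P : finPOrderType disp) : digraph :=
  @Digraph P (fun v1 v2 =>
    [&& (v1 <= v2)%O, v1 != v2
      & [forall w : P, (v1 <= w <= v2)%O ==> ((w == v1) || (w == v2))]]).

(* Main.v *)
(* A Hasse diagram determines its finite poset, since the order is the
   reflexive-transitive closure of the covering relation. In the poset of balls
   the minimal elements are the singletons (balls of radius 0), and a point lies
   in a ball iff its singleton is below it; hence an isomorphism of ball posets
   restricts to a bijection of points that induces it. *)
Require Import Defs.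
From mathcomp Require Import all_boot all_order all_algebra.
From mathcomp Require Import boolp reals.

Import Order.TTheory.

(** A path of arcs composes by transitivity. Conversely, induct on the size of the interval from [x]
    to [y]: if [y] does not cover [x], a [w] strictly between splits it into two strictly smaller
    intervals. *)
Lemma connect_hasse (disp : Order.disp_t) (P : finPOrderType disp) (x y : P) :
  connect (@is_arc (hasse P)) x y = (x <= y)%O.
Proof.
apply/idP/idP.
  case/connectP=> p; elim: p x => [|z p IHp] x /=; first by move=> _ ->.
  by case/andP=> /and3P[xz _ _] pz ey; apply: le_trans xz (IHp _ pz ey).
have [n] := ubnP #|[set z | x <= z <= y]%O|.
elim: n => // n IHn in x y *; rewrite ltnS => lt_n xy.
have [->|neq_xy] := eqVneq x y; first exact: connect0.
have [|] := boolP (@is_arc (hasse P) x y); first exact: connect1.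
rewrite /= xy neq_xy /= negb_forall => /existsP[w].
rewrite negb_imply negb_or => /andP[/andP[xw wy] /andP[wx wy']].
apply: (@connect_trans _ _ w); apply: IHn => //; apply: leq_trans lt_n.
  apply/proper_card/properP; split.
    by apply/subsetP=> z; rewrite !inE => /andP[-> /le_trans->].
  (* The endpoint [y] is lost on passing to the interval from [x] to [w]; dually, [x] is lost in the
     one from [w] to [y]. *)
  exists y; rewrite !inE ?xy ?lexx //= .
  by apply: contra wy' => yw; rewrite eq_le wy.
apply/proper_card/properP; split.
  by apply/subsetP=> z; rewrite !inE => /andP[/(le_trans xw)-> ->].
exists x; rewrite !inE ?xy ?lexx //= andbT.
by apply: contra wx => wx; rewrite eq_le wx.
Qed.

Lemma connect_homo (T U : finType) (e : rel T) (e' : rel U) (F : T -> U) :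
  {homo F : x y / e x y >-> e' x y} ->
  {homo F : x y / connect e x y >-> connect e' x y}.
Proof.
move=> Fh x y /connectP[p pth ->]; apply/connectP; exists (map F p).
  exact: homo_path Fh pth.
by rewrite last_map.
Qed.

Lemma hasse_isoP (d d' : Order.disp_t)
    (P : finPOrderType d) (Q : finPOrderType d') :
  digraph_iso (hasse P) (hasse Q) <->
  exists2 F : P -> Q, bijective F & {mono F : x y / (x <= y)%O}.
Proof.
split=> [[F [[G FK GK] arcF]]|[F [G FK GK] leF]].
  exists F => [|x y]; first by exists G.
  rewrite -!connect_hasse; apply/idP/idP.
    (* Writing [x] and [y] as [G (F x)] and [G (F y)] lets [G] carry the path back. *)
    rewrite -{2}(FK x) -{2}(FK y); apply: connect_homo => u v uv.
    by apply/(arcF (G u) (G v)); rewrite !GK.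
  by apply: connect_homo => u v /(arcF u v).
exists F; split=> [|x y /=]; first by exists G.
suff -> : [forall w : P, (x <= w <= y)%O ==> ((w == x) || (w == y))] =
          [forall w : Q, (F x <= w <= F y)%O ==> ((w == F x) || (w == F y))].
  by rewrite leF (can_eq FK).
apply/forallP/forallP => H w; last by have := H (F w); rewrite !leF !(can_eq FK).
by have := H (G w); rewrite -!leF -!(can_eq FK) !GK.
Qed.

Lemma is_ball_val {R : realType} {X : finSemimetric R} (A : balls X) :
  is_ball (val A).
Proof. exact/asboolP/(valP A). Qed.

Definition ball_of {R : realType} {X : finSemimetric R} {A : {set X}}
  (bA : is_ball A) : balls X := Sub A (asboolT bA).

Lemma is_ball_set1 {R : realType} {X : finSemimetric R} (x : X) :
  is_ball [set x].
Proof.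
have [d_ge0 _ d_eq0] := sdistP X.
exists x, 0%R; split=> //; apply/setP=> y; rewrite !inE.
apply/eqP/idP => [/d_eq0->//|le0]; apply/d_eq0/eqP.
by rewrite eq_le le0 d_ge0.
Qed.

(** The radius is nonnegative, so the centre belongs to the ball. This keeps the empty set out of
    the poset and makes singletons minimal. *)
Lemma is_ball_nonempty {R : realType} {X : finSemimetric R} {A : {set X}} :
  is_ball A -> exists x, x \in A.
Proof.
have [_ _ d_eq0] := sdistP X.
by case=> x [r [r_ge0 ->]]; exists x; rewrite inE (d_eq0 x x).2.
Qed.

Definition ball1 {R : realType} {X : finSemimetric R} (x : X) : balls X :=
  ball_of (is_ball_set1 x).

Lemma ball1_le {R : realType} {X : finSemimetric R} (x : X) (A : balls X) :
  (ball1 x <= A)%O = (x \in val A).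
Proof. exact: sub1set. Qed.

Lemma ball1_inj (R : realType) (X : finSemimetric R) :
  injective (@ball1 R X).
Proof. by move=> x y /(congr1 val) /set1_inj. Qed.

Lemma ball1_min {R : realType} {X : finSemimetric R} {x : X} {A : balls X} :
  (A <= ball1 x)%O -> A = ball1 x.
Proof.
move=> le_Ax; have [y Ay] := is_ball_nonempty (is_ball_val A).
have /set1P eyx : y \in [set x] by apply: (subsetP le_Ax).
by apply: le_anti; rewrite le_Ax ball1_le -eyx.
Qed.

Lemma order_iso_ball1 {R : realType} {X Y : finSemimetric R}
    {F : balls X -> balls Y} {G : balls Y -> balls X} :
  cancel G F -> {mono F : A B / (A <= B)%O} ->
  exists f : X -> Y, forall x, F (ball1 x) = ball1 (f x).
Proof.
move=> GK leF.
suff /choice[f Ff] : forall x, exists y, F (ball1 x) = ball1 y by exists f.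
move=> x.
have [y Fy] := is_ball_nonempty (is_ball_val (F (ball1 x))).
(* For any [y] in [F (ball1 x)], the ball [G (ball1 y)] lies below [ball1 x], so minimality forces
   equality. *)
exists y; rewrite -(GK (ball1 y)); congr F; apply/esym/ball1_min.
by rewrite -leF GK ball1_le.
Qed.

Theorem theorem3p3 (R : realType) (X Y : finSemimetric R) :
  digraph_iso (hasse (balls X)) (hasse (balls Y)) <->
  exists f : X -> Y, bijective f /\ ball_preserving f.
Proof.
rewrite hasse_isoP; split=> [[F [G FK GK] leF]|[f [[g fK gK] [imf pref]]]].
  have leG : {mono G : A B / (A <= B)%O} by move=> A B; rewrite -leF !GK.
  have [f Ff] := order_iso_ball1 GK leF.
  have [g Gg] := order_iso_ball1 FK leG.
  have fK : cancel f g by move=> x; apply: ball1_inj; rewrite -Gg -Ff FK.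
  have gK : cancel g f by move=> y; apply: ball1_inj; rewrite -Ff -Gg GK.
  exists f; split; first by exists g.
  split=> [Z bZ|W bW].
    (* Membership is tested on singletons: [y] lies in the ball [F] assigns to [Z] iff [ball1 (g y)]
       is below [Z]. *)
    suff -> : f @: Z = val (F (ball_of bZ)) by exact: is_ball_val.
    rewrite (can2_imset_pre _ fK gK); apply/setP=> y.
    by rewrite inE -ball1_le -(GK (ball1 y)) leF Gg ball1_le.
  suff -> : f @^-1: W = val (G (ball_of bW)) by exact: is_ball_val.
  apply/setP=> x.
  by rewrite inE -ball1_le -(FK (ball1 x)) leG Ff ball1_le.
(* Conversely, taking images is the order isomorphism and taking preimages its inverse; each half of
   ball preservation makes one of them land in balls. *)
exists (fun A => ball_of (imf _ (is_ball_val A))) => [|A B].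
  exists (fun B => ball_of (pref _ (is_ball_val B))) => A;
    apply/val_inj/setP => x /=.
    by rewrite inE (mem_imset _ _ (can_inj fK)).
  by rewrite (can2_imset_pre _ fK gK) !inE gK.
rewrite [LHS]/Order.le [RHS]/Order.le /= /ball_le /=.
(* Images always preserve inclusion; reflecting it uses injectivity of [f]. *)
apply/idP/idP => [/subsetP sAB|/imsetS-> //]; apply/subsetP => x Ax.
have /sAB : f x \in f @: val A by exact: imset_f.
by rewrite (mem_imset _ _ (can_inj fK)).
Qed.
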